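(* Let $d$ be any non-negative integer constant and let $\Delta = 2d+1$. Then there is a deterministic distributed algorithm in the LOCAL model that runs in $5\Delta^3$ rounds and that finds a maximal fractional matching in every graph of maximum degree at most $\Delta$, using only edge values of the form $a/b$ with $a \in \{0,1,\dotsc,2^d\}$ and $b = 2^d$.
   Context: Fractional matching: for a finite simple graph $G=(V,E)$ and $x\colon E\to[0,1]$, write $x[v]=\sum_{e\in E: v\in e} x(e)$ for $v \in V$. The function $x$ is a fractional matching if $x[v]\le 1$ for all $v\in V$; it is a maximal fractional matching if in addition for every edge $\{u,v\}\in E$ at least one endpoint is saturated, i.e. $x[u]=1$ or $x[v]=1$. PN (port-numbering) model: each node of the input graph $G$ is a computer and each edge is a communication link. An adversary chooses a port numbering: each node $v$ of degree $\deg(v)$ refers to its incident edges by the numbers $1,\dotsc,\deg(v)$. Initially each node knows only its degree (and the global constant $\Delta$), and nodes of the same degree start in the same state. Computation is deterministic and proceeds in synchronous rounds; in each round each node sends a message (of arbitrary size) through each port, receives a message from each port, and updates its state by arbitrary local computation as a function of its current state and the received messages. A node may stop after any number of rounds and announce its local output, here the value $x(e)$ of each incident edge $e$ (the two endpoints of an edge must announce the same value). The running time is the number of rounds until all nodes have stopped. An algorithm must be correct for every input graph in the family and every port numbering. LOCAL model: the same as the PN model, except that each node is additionally given as input a unique identifier, chosen by an adversary from a set of size polynomial in $n=|V|$, e.g. $\{1,\dotsc,n^c\}$ for a fixed constant $c \ge 1$. An algorithm must be correct for every choice of unique identifiers. *)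

(* Defs.v *)
From HB Require Import structures.
From mathcomp Require Import all_boot all_order all_algebra.

Set Implicit Arguments.
Unset Strict Implicit.
Unset Printing Implicit Defensive.

Import Order.TTheory GRing.Theory Num.Theory.

Local Open Scope ring_scope.

Record sgraph := SGraph {
  vertex :> finType;
  adj : rel vertex;
  adj_sym : symmetric adj;
  adj_irr : irreflexive adj }.

Definition edges (G : sgraph) : {set {set G}} :=
  [set [set uv.1; uv.2] | uv : G * G & adj uv.1 uv.2].

Definition deg (G : sgraph) (v : G) : nat := #|[set u | adj v u]|.

Definition max_degree (G : sgraph) : nat := (\max_(v : G) deg v)%N.

(* An edge weighting is a function on all vertex sets;
   only its values on [edges G] are ever used. *)

Definition load (R : realFieldType) (G : sgraph) (x : {set G} -> R) (v : G) : R :=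
  \sum_(e in edges G | v \in e) x e.

Definition fractional_matching (R : realFieldType) (G : sgraph)
    (x : {set G} -> R) : Prop :=
  (forall e, e \in edges G -> 0 <= x e <= 1) /\ (forall v, load x v <= 1).

Definition maximal_fractional_matching (R : realFieldType) (G : sgraph)
    (x : {set G} -> R) : Prop :=
  fractional_matching x /\
  (forall u v : G, adj u v -> load x u = 1 \/ load x v = 1).

(* Deterministic synchronous message-passing algorithms. [I] is the type of
   local inputs, [O] the type of the output announced on each port. Everything
   is indexed by the degree [k] of the node, which the node knows and which
   never changes; the ports of a node of degree k are 0, ..., k-1.
   [out s = None] means that a node in state [s] is still running. A node that
   has stopped sends no more messages, hence the option in [receive]. *)

Record algorithm (I O : Type) := Algorithm {
  state : nat -> Type;
  msg : Type;
  init : forall k, I -> state k;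
  send : forall k, state k -> 'I_k -> msg;
  receive : forall k, state k -> ('I_k -> option msg) -> state k;
  out : forall k, state k -> option ('I_k -> O) }.

(* In a simple graph an edge incident to v is determined by its other end, so
   a numbering of the edges at v is a bijection from ports to neighbours. *)

Record port_numbering (G : sgraph) := PortNumbering {
  nbr : forall v : G, 'I_(deg v) -> G;
  nbr_inj : forall v, injective (@nbr v);
  nbrP : forall v u, adj v u <-> exists p, @nbr v p = u }.

Arguments nbr {G} _ v p.

Lemma back_port_subproof (G : sgraph) (P : port_numbering G) (v : G)
  (p : 'I_(deg v)) : exists q, nbr P (nbr P v p) q == v.
Proof.
have : adj (nbr P v p) v by rewrite adj_sym; apply/(nbrP P); exists p.
by case/(nbrP P) => q /eqP; exists q.
Qed.

(* The port by which the neighbour behind port p of v refers to v. *)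
Definition back_port (G : sgraph) (P : port_numbering G) (v : G)
    (p : 'I_(deg v)) : 'I_(deg (nbr P v p)) :=
  xchoose (back_port_subproof P p).

Arguments back_port {G} P v p.

Definition configuration (I O : Type) (A : algorithm I O) (G : sgraph) :=
  forall v : G, state A (deg v).

Definition message (I O : Type) (A : algorithm I O) (k : nat) (s : state A k)
    (p : 'I_k) : option (msg A) :=
  if out s is None then Some (send s p) else None.

Definition round (I O : Type) (A : algorithm I O) (G : sgraph)
    (P : port_numbering G) (C : configuration A G) : configuration A G :=
  fun v =>
    if out (C v) is None
    then receive (C v)
           (fun p => message (C (nbr P v p)) (back_port P v p))
    else C v.

(* The configuration after t rounds. *)
Definition run (I O : Type) (A : algorithm I O) (G : sgraph)
    (P : port_numbering G) (input : G -> I) (t : nat) : configuration A G :=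
  iter t (@round I O A G P) (fun v => init A (deg v) (input v)).

(* After t rounds every node has stopped, and the two ends of each edge e have
   both announced x e. *)
Definition computes_within (I O : Type) (A : algorithm I O) (G : sgraph)
    (P : port_numbering G) (input : G -> I) (t : nat) (x : {set G} -> O) : Prop :=
  forall v : G, exists2 o : 'I_(deg v) -> O,
    out (run A P input t v) = Some o & forall p, o p = x [set v; nbr P v p].

(* In the LOCAL model the local input is a unique identifier; nodes are not
   given the number of nodes. *)

Definition local_algorithm (O : Type) := algorithm nat O.

Definition unique_identifiers (c : nat) (G : sgraph) (id : G -> nat) : Prop :=
  injective id /\ (forall v, 1 <= id v <= #|G| ^ c)%N.

(* Main.v *)
Require Import Defs.
From HB Require Import structures.
From mathcomp Require Import all_boot all_order all_algebra.
From mathcomp Require Import zify.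

(* Weights are counted in units of 2^-d. At stage i the active nodes have
   residual capacity 2^-i and at most 2(d-i)+1 active neighbours, and every
   edge with an inactive end has a saturated end.

   Odd step, from degree at most 2k+1 to at most 2k. Orient the edges by the
   identifiers and give an arc v -> w the pair (port of w at v, port of v at w)
   as its type. The arcs of one type form disjoint directed paths and cycles,
   so the first arcs of the paths of one type form a matching. A node with more
   leaving than entering arcs starts one of these paths, since the leaving arcs
   of a node have distinct types and so have the entering ones; a node with
   more entering than leaving arcs does so for the reversed orientation. A node
   of odd degree is of one of the two kinds. Treating the 2 Delta^2 matchings
   one by one, greedily, yields a matching such that each active node of odd
   degree is matched or has a matched neighbour. Saturate the matched edges.

   Even step, from degree at most 2k to at most 2k-1. The pairs of ports
   properly colour the edges of the bipartite double cover, so Delta^2 greedy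
   rounds give a maximal matching of it. Each matched copy of an edge gets half
   of the residual capacity, and an edge isolated in the image of the matching
   gets all of it. A node with exactly one matched copy is then either saturated
   or adjacent to a newly saturated node, and a node with no matched copy has
   only saturated active neighbours.

   All this is computed on the graph itself; a function of a node is computable
   in t rounds when it factors through the radius-t view of the node. *)

Set Implicit Arguments.
Unset Strict Implicit.
Unset Printing Implicit Defensive.

Import Order.TTheory GRing.Theory Num.Theory.

(** * Views and locality *)

Section Ports.

Variables (G : sgraph) (P : port_numbering G).

Definition neighbours (v : G) : seq G := [seq nbr P v p | p <- enum 'I_(deg v)].

Definition port (v u : G) : nat := index u (neighbours v).

Lemma mem_neighbours v u : (u \in neighbours v) = adj v u.
Proof.
apply/mapP/idP => [[p _ ->]|/(nbrP P)[p <-]]; first by apply/(nbrP P); exists p.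
by exists p; rewrite ?mem_enum.
Qed.

Lemma size_neighbours v : size (neighbours v) = deg v.
Proof. by rewrite size_map size_enum_ord. Qed.

Lemma port_lt v u : adj v u -> port v u < deg v.
Proof. by move=> vu; rewrite -size_neighbours index_mem mem_neighbours. Qed.

Lemma port_inj v u w : adj v u -> adj v w -> port v u = port v w -> u = w.
Proof.
rewrite -!mem_neighbours => uN wN eq_uw.
by rewrite -(nth_index u uN) -(nth_index u wN) -/(port v u) eq_uw.
Qed.

Lemma port_nbr v p : port v (nbr P v p) = p.
Proof. by rewrite /port index_map ?index_enum_ord//; apply: nbr_inj. Qed.

Lemma adj_nbr v p : adj v (nbr P v p).
Proof. by apply/(nbrP P); exists p. Qed.

Lemma back_portE v p : back_port P v p = port (nbr P v p) v :> nat.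
Proof.
rewrite -(port_nbr (back_port P v p)).
by rewrite (eqP (xchooseP (back_port_subproof P p))).
Qed.

End Ports.

(** The number stored with a neighbour's view is the port by which that neighbour refers to the
    owner; the owner's own port is the position in the list. *)
Inductive view_tree : Type :=
  | Leaf of nat
  | Node of view_tree & seq (nat * view_tree).

Fixpoint view (G : sgraph) (P : port_numbering G) (id : G -> nat) (t : nat)
    (v : G) : view_tree :=
  if t is t'.+1 then
    Node (view P id t' v)
      [seq (nat_of_ord (back_port P v p), view P id t' (nbr P v p)) | p <- enum 'I_(deg v)]
  else Leaf (id v).

Definition node_family (S : Type) :=
  forall G : sgraph, port_numbering G -> (G -> nat) -> G -> S.

Definition arc_family (S : Type) :=
  forall G : sgraph, port_numbering G -> (G -> nat) -> G -> G -> S.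

(** One [g] serves all graphs, port numberings and identifiers; this uniformity is what lets an
    algorithm apply it. *)
Definition local (t : nat) (S : Type) (f : node_family S) : Prop :=
  exists g, forall G (P : port_numbering G) id v, f G P id v = g (view P id t v).

(* Neither end can compute the value alone after [t] rounds: one more round is
   needed to exchange the two views. *)
Definition arc_local (t : nat) (S : Type) (F : arc_family S) : Prop :=
  exists g : nat -> nat -> view_tree -> view_tree -> S,
    forall G (P : port_numbering G) id v u, adj v u ->
      F G P id v u = g (port P v u) (port P u v) (view P id t v) (view P id t u).

Definition view_pred (x : view_tree) : view_tree := if x is Node y _ then y else x.

Lemma localS t S (f : node_family S) : local t f -> local t.+1 f.
Proof. by case=> g fE; exists (g \o view_pred) => G P id v; rewrite fE. Qed.

Lemma local_le t t' S (f : node_family S) : t <= t' -> local t f -> local t' f.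
Proof.
by move=> /subnK<-; elim: (t' - t)%N => // k IHk /IHk; apply: localS.
Qed.

Lemma arc_localS t S (F : arc_family S) : arc_local t F -> arc_local t.+1 F.
Proof.
case=> g FE; exists (fun p q x y => g p q (view_pred x) (view_pred y)).
by move=> G P id v u vu; rewrite FE.
Qed.

Lemma arc_local_le t t' S (F : arc_family S) :
  t <= t' -> arc_local t F -> arc_local t' F.
Proof.
by move=> /subnK<-; elim: (t' - t)%N => // k IHk /IHk; apply: arc_localS.
Qed.

Lemma local_map2 t S1 S2 S (h : S1 -> S2 -> S)
    (f1 : node_family S1) (f2 : node_family S2) :
  local t f1 -> local t f2 ->
  local t (fun G P id v => h (f1 G P id v) (f2 G P id v)).
Proof.
case=> g1 f1E [g2 f2E]; exists (fun x => h (g1 x) (g2 x)) => G P id v.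
by rewrite f1E f2E.
Qed.

Lemma arc_local_map2 t S1 S2 S (h : S1 -> S2 -> S)
    (F1 : arc_family S1) (F2 : arc_family S2) :
  arc_local t F1 -> arc_local t F2 ->
  arc_local t (fun G P id v u => h (F1 G P id v u) (F2 G P id v u)).
Proof.
case=> g1 F1E [g2 F2E].
exists (fun p q x y => h (g1 p q x y) (g2 p q x y)) => G P id v u vu.
by rewrite F1E ?F2E.
Qed.

Lemma arc_local_map t S1 S (h : S1 -> S) (F1 : arc_family S1) :
  arc_local t F1 -> arc_local t (fun G P id v u => h (F1 G P id v u)).
Proof. by move=> F1l; apply: (arc_local_map2 (fun x _ => h x) F1l F1l). Qed.

Lemma arc_local_rev t S (F : arc_family S) :
  arc_local t F -> arc_local t (fun G P id v u => F G P id u v).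
Proof.
case=> g FE; exists (fun p q x y => g q p y x) => G P id v u vu.
by rewrite FE // adj_sym.
Qed.

Lemma arc_local_const t S (a : S) : arc_local t (fun _ _ _ _ _ => a).
Proof. by exists (fun _ _ _ _ => a). Qed.

Lemma arc_local_adj t : arc_local t (fun G _ _ v u => @adj G v u).
Proof. by exists (fun _ _ _ _ => true) => G P id v u ->. Qed.

Lemma arc_local_port t : arc_local t (fun _ P _ v u => port P v u).
Proof. by exists (fun p _ _ _ => p). Qed.

Lemma arc_local_tail t S (f : node_family S) :
  local t f -> arc_local t (fun G P id v _ => f G P id v).
Proof. by case=> g fE; exists (fun _ _ x _ => g x) => G P id v u _; rewrite fE. Qed.

Lemma arc_local_head t S (f : node_family S) :
  local t f -> arc_local t (fun G P id _ u => f G P id u).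
Proof. by case=> g fE; exists (fun _ _ _ x => g x) => G P id v u _; rewrite fE. Qed.

Lemma local_id t : local t (fun _ _ id v => id v).
Proof.
apply: (@local_le 0) => //.
by exists (fun x => if x is Leaf i then i else 0).
Qed.

Lemma local_neighbours t S (F : arc_family S) : arc_local t F ->
  local t.+1 (fun G P id v => [seq F G P id v u | u <- neighbours P v]).
Proof.
case=> g FE.
(* The extra round delivers the neighbours' ports and views, the missing arguments of [g]. The
   default [(0, x)] is never reached, as [i < size s]. *)
exists (fun x => if x is Node y s then
   [seq g i (nth (0, x) s i).1 y (nth (0, x) s i).2 | i <- iota 0 (size s)] else [::]).
move=> G P id v /=; rewrite -map_comp size_map size_enum_ord -val_enum_ord -map_comp.
apply: eq_map => p /=; rewrite FE ?adj_nbr // port_nbr.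
by rewrite (nth_map p) ?size_enum_ord // nth_ord_enum back_portE.
Qed.

Lemma local_exists t (F : arc_family bool) : arc_local t F ->
  local t.+1 (fun G P id v => [exists u, adj v u && F G P id v u]).
Proof.
move=> /local_neighbours[g gE].
exists (fun x => has (fun b => b) (g x)) => G P id v; rewrite -gE has_map.
by apply/existsP/hasP => -[u]; [case/andP|]; exists u; rewrite ?mem_neighbours //;
  apply/andP; rewrite -(mem_neighbours P).
Qed.

(* In a state [s], [s.1] counts the rounds and [s.2] is the view. *)
Definition view_algorithm (O : Type) (T : nat) (g : view_tree -> nat -> O) :
    local_algorithm O :=
  @Algorithm nat O (fun _ => (nat * view_tree)%type) (nat * view_tree)%type
    (fun _ i => (0, Leaf i))
    (fun _ s q => (nat_of_ord q, s.2))
    (fun k s m => (s.1.+1, Node s.2 [seq odflt (0, Leaf 0) (m p) | p <- enum 'I_k]))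
    (fun _ s => if s.1 == T then Some (fun p => g s.2 (nat_of_ord p)) else None).

(** No node stops before round [T], so every message is delivered and the default [(0, Leaf 0)] is
    never read. *)
Lemma view_algorithm_run O T (g : view_tree -> nat -> O) (G : sgraph)
    (P : port_numbering G) (id : G -> nat) t v :
  t <= T -> run (view_algorithm T g) P id t v = (t, view P id t v).
Proof.
elim: t v => // t IHt v ltT; rewrite /run iterS -/(run _ _ _ _) /round /=.
have {}IHt u : run (view_algorithm T g) P id t u = (t, view P id t u).
  exact: IHt (ltnW ltT).
rewrite IHt /= (ltn_eqF ltT); congr (_, Node _ _).
by apply: eq_map => p; rewrite /message /= IHt /= (ltn_eqF ltT).
Qed.

Lemma local_computes O T (f : node_family (nat -> O)) : local T f ->
  exists A : local_algorithm O, forall G (P : port_numbering G) id (x : {set G} -> O),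
    (forall v p, f G P id v (port P v (nbr P v p)) = x [set v; nbr P v p]) ->
    computes_within A P id T x.
Proof.
case=> g fE; exists (view_algorithm T g) => G P id x fx v.
exists (fun p => g (view P id T v) p).
  by rewrite view_algorithm_run //= eqxx.
by move=> p; rewrite -fE -fx port_nbr.
Qed.

(** * Greedy matchings *)

Section Greedy.

Variables (G : sgraph) (m : bool) (C : nat -> rel G).

Definition out_arc (K : rel G) (v : G) : bool := [exists w, adj v w && K v w].
Definition in_arc (K : rel G) (v : G) : bool := [exists w, adj v w && K w v].

(** With [m] false the tail and head copies of a node are separate, as in the bipartite double
    cover; with [m] true they are identified and matchings of the graph itself result. *)
Definition used_out (K : rel G) (v : G) : bool := out_arc K v || (m && in_arc K v).
Definition used_in (K : rel G) (v : G) : bool := in_arc K v || (m && out_arc K v).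

(** All arcs of a class are decided simultaneously, so each class must itself be a matching;
    [C_out], [C_in] and, for [m] true, [C_chain] will require this. *)
Fixpoint greedy (n : nat) : rel G :=
  if n is i.+1 then fun v w =>
    greedy i v w || C i v w && (~~ used_out (greedy i) v && ~~ used_in (greedy i) w)
  else fun _ _ => false.

Lemma greedy_sub n v w : greedy n v w -> exists2 i, i < n & C i v w.
Proof.
elim: n => //= n IHn /orP[/IHn[i lti Ci]|/andP[Cn _]]; last by exists n.
by exists i => //; apply: ltnW.
Qed.

Lemma used_out_sub (K K' : rel G) v :
  (forall u w, K u w -> K' u w) -> used_out K v -> used_out K' v.
Proof.
move=> KK'; case/orP=> [/existsP[w /andP[vw /KK' Kw]]|].
  by apply/orP; left; apply/existsP; exists w; rewrite vw.
case/andP=> mT /existsP[w /andP[vw /KK' Kw]].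
by apply/orP; right; rewrite mT; apply/existsP; exists w; rewrite vw.
Qed.

Lemma used_in_sub (K K' : rel G) v :
  (forall u w, K u w -> K' u w) -> used_in K v -> used_in K' v.
Proof.
move=> KK'; case/orP=> [/existsP[w /andP[vw /KK' Kw]]|].
  by apply/orP; left; apply/existsP; exists w; rewrite vw.
case/andP=> mT /existsP[w /andP[vw /KK' Kw]].
by apply/orP; right; rewrite mT; apply/existsP; exists w; rewrite vw.
Qed.

Hypothesis C_adj : forall i v w, C i v w -> adj v w.

Lemma greedy_adj n v w : greedy n v w -> adj v w.
Proof. by case/greedy_sub=> i _ /C_adj. Qed.

Lemma greedy_out_arc n v w : greedy n v w -> out_arc (greedy n) v.
Proof. by move=> K; apply/existsP; exists w; rewrite (greedy_adj K). Qed.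

Lemma greedy_in_arc n v w : greedy n v w -> in_arc (greedy n) w.
Proof. by move=> K; apply/existsP; exists v; rewrite adj_sym (greedy_adj K). Qed.

(** When class [i] is treated, the arc is either blocked at an end, and used ends stay used, or
    added, which makes its tail used. *)
Lemma greedy_max n i v w : i < n -> C i v w ->
  used_out (greedy n) v || used_in (greedy n) w.
Proof.
elim: n => // n IHn; rewrite ltnS leq_eqVlt => /orP[/eqP->|lti] Cvw.
  have [|unused] := boolP (used_out (greedy n) v || used_in (greedy n) w).
    case/orP=> [uv|uw]; apply/orP; [left|right].
      by apply: used_out_sub uv => u1 u2 /= ->.
    by apply: used_in_sub uw => u1 u2 /= ->.
  apply/orP; left; apply/orP; left; apply: (@greedy_out_arc n.+1 v w) => /=.
  by rewrite Cvw -negb_or unused orbT.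
case/orP: (IHn lti Cvw) => [uv|uw]; apply/orP; [left|right].
  by apply: used_out_sub uv => u1 u2 /= ->.
by apply: used_in_sub uw => u1 u2 /= ->.
Qed.

Hypothesis C_out : forall i v w w', C i v w -> C i v w' -> w = w'.
Hypothesis C_in : forall i v v' w, C i v w -> C i v' w -> v = v'.

Lemma greedy_out n v w w' : greedy n v w -> greedy n v w' -> w = w'.
Proof.
elim: n => //= n IHn /orP[Kw|/and3P[Cw + _]] /orP[Kw'|/and3P[Cw' + _]].
- exact: IHn Kw Kw'.
- by rewrite negb_or (greedy_out_arc Kw).
- by rewrite negb_or (greedy_out_arc Kw').
- by move=> _ _; apply: C_out Cw Cw'.
Qed.

Lemma greedy_in n v v' w : greedy n v w -> greedy n v' w -> v = v'.
Proof.
elim: n => //= n IHn /orP[Kw|/and3P[Cw _ +]] /orP[Kw'|/and3P[Cw' _ +]].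
- exact: IHn Kw Kw'.
- by rewrite negb_or (greedy_in_arc Kw).
- by rewrite negb_or (greedy_in_arc Kw').
- by move=> _ _; apply: C_in Cw Cw'.
Qed.

Hypothesis C_chain : m -> forall i v w u, C i v w -> C i w u -> False.

(** Whichever of the two arcs came first made [w] used for the other; arcs added together are
    excluded by [C_chain]. *)
Lemma greedy_chain n v w u : m -> greedy n v w -> greedy n w u = false.
Proof.
move=> mT; elim: n => //= n IHn /orP[Kw|/and3P[Cw _ usedw]]; apply/negP.
  case/orP => [|/and3P[_ + _]]; first by rewrite IHn.
  by rewrite /used_out mT (greedy_in_arc Kw) orbT.
case/orP => [Kw|/and3P[Cu _ _]]; last exact: (C_chain mT Cw Cu).
by move: usedw; rewrite /used_in mT (greedy_out_arc Kw) orbT.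
Qed.

End Greedy.

(** * The odd and even steps *)

(** Turns the load that a matching brings to a node into the truth value of being matched. *)
Lemma sum_unique (T : finType) (Q p : pred T) :
  (forall a b, Q a -> Q b -> p a -> p b -> a = b) ->
  \sum_(a | Q a) (p a : nat) = [exists a, Q a && p a].
Proof.
move=> uniq_p; case: existsP => [[a /andP[Qa pa]]|none].
  rewrite (bigD1 a) //= pa big1 ?addn0 // => b /andP[Qb /eqP nab].
  by case pb: (p b) => //; case: nab; apply: uniq_p.
rewrite big1 // => a Qa; case pa: (p a) => //.
by case: none; exists a; rewrite Qa.
Qed.

Definition wload (G : sgraph) (x : G -> G -> nat) (v : G) : nat :=
  \sum_(u | adj v u) x v u.

Definition active_deg (G : sgraph) (act : pred G) (v : G) : nat :=
  #|[set u | adj v u && act u]|.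

(* [N] is the load of a saturated node; active nodes have [s] left. *)
Definition partial_solution (G : sgraph) (N s k : nat) (act : pred G)
    (x : G -> G -> nat) : Prop :=
  [/\ forall v u, x v u = x u v,
      forall v, wload x v <= N,
      forall v, act v -> wload x v + s = N,
      forall v u, adj v u -> ~~ (act v && act u) -> wload x v = N \/ wload x u = N
    & forall v, act v -> active_deg act v <= k].

Section Step.

Variables (Delta : nat) (G : sgraph) (P : port_numbering G) (id : G -> nat).
Hypothesis degG : forall v : G, deg v <= Delta.
Hypothesis id_inj : injective id.

Lemma active_deg_dec (act act' : pred G) k v w :
  (forall u, act' u -> act u) -> active_deg act v <= k.+1 ->
  adj v w -> act w -> ~~ act' w -> active_deg act' v <= k.
Proof.
move=> sub_act le_k vw aw naw'; rewrite -ltnS; apply: leq_trans le_k.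
apply: proper_card; apply/properP; split.
  by apply/subsetP=> u; rewrite !inE => /andP[-> /sub_act].
by exists w; rewrite !inE vw ?aw.
Qed.

(** A pair of ports is coded by its two base-[Delta] digits, so that types can index the rounds of
    [greedy]. *)
Definition has_type (t : nat) (v w : G) : bool :=
  (port P v w == t %/ Delta) && (port P w v == t %% Delta).

Definition type_of (v w : G) : nat := port P v w * Delta + port P w v.

Lemma port_ltDelta v w : adj v w -> port P v w < Delta.
Proof. by move=> /(port_lt P)/leq_trans; apply. Qed.

Lemma has_type_of v w v' w' : adj v w ->
  has_type (type_of v w) v' w' =
  (port P v' w' == port P v w) && (port P w' v' == port P w v).
Proof.
rewrite adj_sym /has_type /type_of => /port_ltDelta ltD.
by rewrite divnMDl ?modnMDl ?divn_small ?modn_small ?addn0 //; case: (Delta) ltD.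
Qed.

Lemma type_of_lt v w : adj v w -> type_of v w < Delta ^ 2.
Proof.
move=> vw; have := port_ltDelta vw; rewrite adj_sym in vw.
have := port_ltDelta vw; rewrite /type_of; nia.
Qed.

Lemma has_type_out t v w w' : adj v w -> adj v w' ->
  has_type t v w -> has_type t v w' -> w = w'.
Proof.
move=> vw vw' /andP[/eqP e _] /andP[/eqP e' _].
by apply: (@port_inj _ P _ _ _ vw vw'); rewrite e e'.
Qed.

Lemma has_type_in t v v' w : adj v w -> adj v' w ->
  has_type t v w -> has_type t v' w -> v = v'.
Proof.
rewrite ![adj _ w]adj_sym => vw vw' /andP[_ /eqP e] /andP[_ /eqP e'].
by apply: (@port_inj _ P _ _ _ vw vw'); rewrite e e'.
Qed.

(** * Lowering an odd degree bound by a matching of the graph *)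

Section OddStep.

Variables (act : pred G) (x : G -> G -> nat) (s : nat).

Definition act_arc (b : bool) (v w : G) : bool :=
  adj v w && (act v && act w && (if b then id w < id v else id v < id w)).

(* The arcs of one port type form directed paths and cycles; the class consists
   of the first arc of each path. *)
Definition odd_class (i : nat) (v w : G) : bool :=
  act_arc (odd i) v w && has_type i./2 v w &&
  ~~ [exists u, adj v u && (act_arc (odd i) u v && has_type i./2 u v)].

Definition odd_matching : rel G := greedy true odd_class (2 * Delta ^ 2).

Definition odd_matched (v : G) : bool := out_arc odd_matching v || in_arc odd_matching v.

Definition odd_active (v : G) : bool := act v && ~~ odd_matched v.

Definition odd_weight (v w : G) : nat :=
  x v w + s * (odd_matching v w || odd_matching w v).

Lemma odd_class_adj i v w : odd_class i v w -> adj v w.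
Proof. by case/andP=> /andP[/andP[]]. Qed.

Lemma odd_class_out i v w w' : odd_class i v w -> odd_class i v w' -> w = w'.
Proof.
case/andP=> /andP[/andP[vw _] ty] _ /andP[/andP[/andP[vw' _] ty'] _].
exact: has_type_out ty ty'.
Qed.

Lemma odd_class_in i v v' w : odd_class i v w -> odd_class i v' w -> v = v'.
Proof.
case/andP=> /andP[/andP[vw _] ty] _ /andP[/andP[/andP[vw' _] ty'] _].
exact: has_type_in ty ty'.
Qed.

(** The first arc enters [w] with the type of the second, which is therefore not the first of its
    path. *)
Lemma odd_class_chain i v w u : odd_class i v w -> odd_class i w u -> False.
Proof.
case/andP=> /andP[arc ty] _ /andP[_ /negP[]].
by apply/existsP; exists v; rewrite adj_sym arc ty; case/andP: arc => ->.
Qed.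

(* If every arc leaving [v] were preceded by an arc of its own type entering
   [v], then [v] would have at least as many entering as leaving arcs. *)
Lemma first_arc b v :
  #|[set u | act_arc b u v]| < #|[set w | act_arc b v w]| ->
  exists i w, i < 2 * Delta ^ 2 /\ odd_class i v w.
Proof.
move=> lt_io; pose prec w u := act_arc b u v && has_type (type_of v w) u v.
have [/existsP[w /andP[arc none]]|] :=
    boolP [exists w, act_arc b v w && ~~ [exists u, prec w u]].
  have vw : adj v w by case/andP: arc.
  (* The parity of a class index holds the orientation and its half the type, whence twice
     [Delta ^ 2] classes. *)
  exists (b + (type_of v w).*2), w; split.
    by have := type_of_lt vw; case: b {lt_io prec arc none}; lia.
  rewrite /odd_class oddD odd_double addbF half_bit_double oddb arc /=.
  rewrite has_type_of // !eqxx /=; apply: contra none => /existsP[u].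
  by case/andP=> _ puv; apply/existsP; exists u.
rewrite negb_exists => /forallP all_prec.
pose f w := odflt v [pick u | prec w u].
have fP w : act_arc b v w -> prec w (f w).
  move=> arc; rewrite /f; case: pickP => //= none.
  by have := all_prec w; rewrite arc negbK => /existsP[u]; rewrite none.
(* The predecessor [u = f w] has the type of [v -> w], so the port of [v] at [u] equals that of [w]
   at [v]; thus [u] determines [w]. *)
have f_inj : {in [set w | act_arc b v w] &, injective f}.
  move=> w w'; rewrite !inE => arc arc' eq_f.
  have vw : adj v w by case/andP: arc.
  have vw' : adj v w' by case/andP: arc'.
  move: (fP w arc) (fP w' arc'); rewrite /prec eq_f !has_type_of //.
  case/andP=> _ /andP[/eqP e _] /andP[_ /andP[/eqP e' _]].
  by apply: (@port_inj _ P _ _ _ vw vw'); rewrite -e -e'.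
move: lt_io; rewrite ltnNge -(card_in_imset f_inj) subset_leq_card //.
by apply/subsetP=> _ /imsetP[w + ->]; rewrite !inE => /fP/andP[].
Qed.

Lemma odd_first_arc v : act v -> odd (active_deg act v) ->
  exists i w, i < 2 * Delta ^ 2 /\ odd_class i v w.
Proof.
move=> av odd_deg.
pose O b := [set w | act_arc b v w].
(* Reversing the orientation exchanges leaving and entering arcs, so [O true] and [O false] count
   both kinds for a single orientation. *)
have OI b : O (~~ b) = [set u | act_arc b u v].
  apply/setP=> u; rewrite !inE /act_arc adj_sym [act u && _]andbC.
  by case: b.
have degE : active_deg act v = #|O true| + #|O false|.
  have disj : O true :&: O false = set0.
    by apply/setP=> u; rewrite !inE /act_arc; case: ltngtP; rewrite ?andbF.
  rewrite -cardsUI disj cards0 addn0.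
  apply: eq_card => u; rewrite !inE /act_arc av.
  case vu: (adj v u) => //=; case au: (act u) => //=.
  (* Distinct identifiers orient every edge, so no active neighbour escapes both sets. *)
  have: id v != id u.
    by apply/eqP=> /id_inj eq_vu; move: vu; rewrite eq_vu adj_irr.
  by case: ltngtP.
have: #|O true| != #|O false|.
  by apply: contraTneq odd_deg => eqO; rewrite degE eqO addnn odd_double.
case: ltngtP => // ltO _; [apply: (@first_arc false)|apply: (@first_arc true)].
  by rewrite -(OI false).
by rewrite -(OI true).
Qed.

Lemma odd_matching_act v w : odd_matching v w -> act v && act w.
Proof. by case/greedy_sub=> i _ /andP[/andP[/andP[_ /andP[-> _]]]]. Qed.

(** The arcs form a matching even after forgetting directions: [greedy_chain] excludes two arcs
    meeting head to tail. *)
Lemma odd_matching_unique v a b :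
  odd_matching v a || odd_matching a v ->
  odd_matching v b || odd_matching b v -> a = b.
Proof.
have chain u1 u2 u3 : odd_matching u1 u2 -> odd_matching u2 u3 -> False.
  move=> K1 K2.
  move: K2; rewrite /odd_matching.
  by rewrite (greedy_chain odd_class_adj (fun _ => odd_class_chain) u3 isT K1).
case/orP=> Ka /orP[] Kb.
- exact: (greedy_out odd_class_adj odd_class_out Ka Kb).
- by case: (chain _ _ _ Kb Ka).
- by case: (chain _ _ _ Ka Kb).
- exact: (greedy_in odd_class_adj odd_class_in Ka Kb).
Qed.

Lemma odd_matchedE v :
  odd_matched v = [exists w, adj v w && (odd_matching v w || odd_matching w v)].
Proof.
apply/orP/existsP => [[] /existsP[w /andP[vw K]]|[w /andP[vw /orP[] K]]].
- by exists w; rewrite vw K.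
- by exists w; rewrite vw K orbT.
- by left; apply/existsP; exists w; rewrite vw.
- by right; apply/existsP; exists w; rewrite vw.
Qed.

Lemma wload_odd v : wload odd_weight v = wload x v + s * odd_matched v.
Proof.
rewrite /wload big_split -big_distrr /= odd_matchedE sum_unique //.
by move=> a b _ _; apply: odd_matching_unique.
Qed.

Lemma odd_matched_act v : odd_matched v -> act v.
Proof.
by case/orP=> /existsP[w /andP[_ /odd_matching_act/andP[]]].
Qed.

Lemma odd_stepP N k : ~~ odd k ->
  partial_solution N s k.+1 act x -> partial_solution N s k odd_active odd_weight.
Proof.
move=> even_k [x_sym x_le x_act x_max x_deg]; split.
- by move=> v u; rewrite /odd_weight x_sym orbC.
- move=> v; rewrite wload_odd; case: (boolP (odd_matched v)) => [mv|_].
    by rewrite muln1 x_act // odd_matched_act.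
  by rewrite muln0 addn0.
- move=> v /andP[av /negPf mv]; rewrite wload_odd mv muln0 addn0; exact: x_act.
- have sat v : act v -> odd_matched v -> wload odd_weight v = N.
    by move=> av mv; rewrite wload_odd mv muln1 x_act.
  have le_sat v : wload x v = N -> wload odd_weight v = N.
    rewrite wload_odd; case: (boolP (odd_matched v)) => [mv|_]; last by rewrite muln0 addn0.
    by move: (x_act v (odd_matched_act mv)); rewrite muln1.
  move=> v u vu inact; case av: (act v); last first.
    by case: (x_max v u vu); rewrite ?av // => /le_sat; [left|right].
  case au: (act u); last first.
    by case: (x_max v u vu); rewrite ?au ?andbF // => /le_sat; [left|right].
  move: inact; rewrite /odd_active av au /= -negb_or negbK.
  by case/orP=> /sat; [left; auto|right; auto].
- move=> v /andP[av nmv]; have sub u : odd_active u -> act u by case/andP.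
  move: (x_deg v av); rewrite leq_eqVlt => /orP[/eqP degv|]; last first.
    rewrite ltnS; apply: leq_trans; apply: subset_leq_card.
    by apply/subsetP=> u; rewrite !inE => /andP[-> /sub].
  (* A node attaining the odd bound [k.+1] is the tail of some class arc. As it is unmatched,
     [greedy_max] shows that the head [w] is matched and leaves the active set. *)
  have [|i [w [lti Cvw]]] := odd_first_arc av; first by rewrite degv.
  have [vw aw] : adj v w /\ act w.
    by case/andP: Cvw => /andP[/andP[? /andP[/andP[_ ?] _]]].
  apply: (active_deg_dec sub _ vw aw); first by rewrite degv.
  rewrite /odd_active aw /= negbK.
  have := greedy_max true odd_class_adj lti Cvw.
  rewrite /used_out /used_in /= -!/odd_matching -/(odd_matched v).
  by rewrite (negPf nmv) /= orbC.
Qed.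

End OddStep.

(** * Lowering an even degree bound through the bipartite double cover *)

Section EvenStep.

Variables (act : pred G) (x : G -> G -> nat) (s : nat).

Definition even_class (i : nat) (v w : G) : bool :=
  adj v w && (act v && act w && has_type i v w).

(* A matching of the bipartite double cover, the arc [(v, w)] standing for the
   edge between the first copy of [v] and the second copy of [w]. *)
Definition double_matching : rel G := greedy false even_class (Delta ^ 2).

(** Projected to the graph, the matching consists of directed paths and cycles; these are the paths
    with one arc. *)
Definition single (v w : G) : bool :=
  double_matching v w && (~~ in_arc double_matching v && ~~ out_arc double_matching w).

Definition lone (v : G) : bool := [exists w, adj v w && (single v w || single w v)].

(** The ends of paths with at least two arcs remain. Active nodes with no matched copy are dropped
    with capacity left, which is harmless as their active neighbours become saturated. *)
Definition even_active (v : G) : bool :=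
  act v && ((out_arc double_matching v (+) in_arc double_matching v) && ~~ lone v).

(** Here [s] is half of the residual capacity; the [single] term supplies the second half on a path
    with one arc. *)
Definition even_weight (v w : G) : nat :=
  x v w + s * (double_matching v w + (double_matching w v + (single v w || single w v))).

Local Notation K := double_matching.

Lemma even_class_adj i v w : even_class i v w -> adj v w.
Proof. by case/andP. Qed.

Lemma even_class_out i v w w' : even_class i v w -> even_class i v w' -> w = w'.
Proof. by case/andP=> vw /andP[_ ty] /andP[vw' /andP[_ ty']]; apply: has_type_out ty ty'. Qed.

Lemma even_class_in i v v' w : even_class i v w -> even_class i v' w -> v = v'.
Proof. by case/andP=> vw /andP[_ ty] /andP[vw' /andP[_ ty']]; apply: has_type_in ty ty'. Qed.

Lemma double_matching_act v w : K v w -> [/\ adj v w, act v & act w].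
Proof. by case/greedy_sub=> i _ /andP[-> /andP[/andP[-> ->]]]. Qed.

Lemma double_matching_out v w w' : K v w -> K v w' -> w = w'.
Proof. exact: (greedy_out even_class_adj even_class_out). Qed.

Lemma double_matching_in v v' w : K v w -> K v' w -> v = v'.
Proof. exact: (greedy_in even_class_adj even_class_in). Qed.

Lemma double_out_arc v w : K v w -> out_arc K v.
Proof. exact: (greedy_out_arc even_class_adj). Qed.

Lemma double_in_arc v w : K v w -> in_arc K w.
Proof. exact: (greedy_in_arc even_class_adj). Qed.

Lemma double_matching_max v w : adj v w -> act v -> act w -> out_arc K v || in_arc K w.
Proof.
move=> vw av aw.
have Cvw : even_class (type_of v w) v w.
  by rewrite /even_class vw av aw has_type_of // !eqxx.
have := greedy_max false even_class_adj (type_of_lt vw) Cvw.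
by rewrite /used_out /used_in /= !orbF.
Qed.

Lemma wload_even v :
  wload even_weight v = wload x v + s * (out_arc K v + (in_arc K v + lone v)).
Proof.
rewrite /wload big_split -big_distrr /= !big_split /= !sum_unique //.
- move=> a b _ _ /orP[] /and3P[Ka na na'] /orP[] /and3P[Kb nb nb'].
  + exact: double_matching_out Ka Kb.
  + by rewrite (double_in_arc Kb) in na.
  + by rewrite (double_in_arc Ka) in nb.
  + exact: double_matching_in Ka Kb.
- by move=> a b _ _; apply: double_matching_in.
- by move=> a b _ _; apply: double_matching_out.
Qed.

Lemma loneP v : lone v -> [/\ act v & out_arc K v (+) in_arc K v].
Proof.
case/existsP=> w /andP[_ /orP[] /and3P[Kvw n1 n2]].
  case: (double_matching_act Kvw) => _ av _.
  by rewrite (negPf n1) (double_out_arc Kvw).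
case: (double_matching_act Kvw) => _ _ av.
by rewrite (negPf n2) (double_in_arc Kvw).
Qed.

Lemma even_inactive v : ~~ act v ->
  [/\ out_arc K v = false, in_arc K v = false & lone v = false].
Proof.
move=> nav; split; apply: contraNF nav.
- by case/existsP=> w /andP[_ /double_matching_act[]].
- by case/existsP=> w /andP[_ /double_matching_act[]].
- by case/loneP.
Qed.

Lemma even_stepP N k : partial_solution N (2 * s) k.+1 act x ->
  partial_solution N s k even_active even_weight.
Proof.
move=> [x_sym x_le x_act x_max x_deg].
have sat v : act v -> (out_arc K v && in_arc K v) || lone v -> wload even_weight v = N.
  move=> av; rewrite wload_even => h; rewrite -(x_act v av); congr addn.
  case: (boolP (lone v)) h => [/loneP[_]|_].
    by case: (out_arc K v); case: (in_arc K v) => // _ _; lia.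
  by case: (out_arc K v); case: (in_arc K v) => // _; lia.
have keep v : ~~ act v -> wload even_weight v = wload x v.
  by move=> /even_inactive[o i l]; rewrite wload_even o i l; lia.
have le_sat v : wload x v = N -> wload even_weight v = N.
  case: (boolP (act v)) => [av|/keep-> //] xN; have := x_act v av.
  by rewrite wload_even; lia.
split.
- move=> v u; rewrite /even_weight x_sym; congr (_ + s * _).
  by rewrite [single v u || _]orbC; lia.
- move=> v; case: (boolP (act v)) => [av|/keep-> //].
  rewrite wload_even -(x_act v av) leq_add2l.
  case: (boolP (lone v)) => [/loneP[_]|_].
    by case: (out_arc K v); case: (in_arc K v) => // _; lia.
  by case: (out_arc K v); case: (in_arc K v) => //; lia.
- move=> v /and3P[av + nl]; rewrite wload_even -(x_act v av) (negPf nl).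
  by case: (out_arc K v); case: (in_arc K v) => // _; lia.
- move=> v u vu inact; case av: (act v); last first.
    by case: (x_max v u vu); rewrite ?av // => /le_sat; [left|right].
  case au: (act u); last first.
    by case: (x_max v u vu); rewrite ?au ?andbF // => /le_sat; [left|right].
  (* A dropped node that is not lone has both copies matched, hence is saturated, or none; in the
     latter case maximality in both directions matches both copies of the other node. *)
  have := double_matching_max vu av au.
  have uv : adj u v by rewrite adj_sym.
  have := double_matching_max uv au av.
  move: inact (sat v av) (sat u au); rewrite /even_active av au /=.
  case: (lone v); first by rewrite orbT; left; auto.
  case: (lone u); first by rewrite orbT; right; auto.
  rewrite !andbT !orbF.
  by case: (out_arc K v); case: (in_arc K v); case: (out_arc K u); case: (in_arc K u);
    move=> //= _ h1 h2 _ _; auto.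
- move=> v /and3P[av xorv nlv]; have sub u : even_active u -> act u by case/andP.
  (* Let [w] be the other end of the only arc at [v]. If [w] stayed active it would have no further
     arc, and [v] would be lone. *)
  have [out_v|nout_v] := boolP (out_arc K v).
    case/existsP: (out_v) => w /andP[vw Kvw].
    have [_ _ aw] := double_matching_act Kvw.
    apply: (active_deg_dec sub (x_deg v av) vw aw).
    rewrite /even_active aw (double_in_arc Kvw) addbT /=.
    apply: contra nlv => /andP[nout_w _]; apply/existsP; exists w.
    by rewrite vw /single Kvw nout_w andbT; move: xorv; rewrite out_v addTb => ->.
  have in_v : in_arc K v by move: xorv; rewrite (negPf nout_v).
  case/existsP: (in_v) => w /andP[vw Kwv].
  have [_ aw _] := double_matching_act Kwv.
  apply: (active_deg_dec sub (x_deg v av) vw aw).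
  rewrite /even_active aw (double_out_arc Kwv) addTb /=.
  apply: contra nlv => /andP[nin_w _]; apply/existsP; exists w.
  by rewrite vw /single Kwv nin_w nout_v orbT.
Qed.

End EvenStep.

End Step.

(** * Round counts *)

Lemma local_out_arc t (K : arc_family bool) :
  arc_local t K -> local t.+1 (fun G P id v => out_arc (K G P id) v).
Proof. exact: local_exists. Qed.

Lemma local_in_arc t (K : arc_family bool) :
  arc_local t K -> local t.+1 (fun G P id v => in_arc (K G P id) v).
Proof. by move/arc_local_rev/local_exists. Qed.

(** Each class costs one round, in which every node learns whether its copies are already used. *)
Lemma arc_local_greedy t m (C : nat -> arc_family bool) n :
  (forall i, arc_local t (C i)) ->
  arc_local (t + n) (fun G P id v w => greedy m (fun i => C i G P id) n v w).
Proof.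
move=> C_local; elim: n => [|n IHn] /=; first exact: arc_local_const.
have outK := local_out_arc IHn; have inK := local_in_arc IHn.
rewrite addnS; apply: arc_local_map2; first exact: arc_localS.
apply: arc_local_map2; first by apply: arc_local_le (C_local n); lia.
apply: arc_local_map2; apply: arc_local_map.
  exact: (arc_local_tail (local_map2 (fun a b => a || m && b) outK inK)).
exact: (arc_local_head (local_map2 (fun a b => a || m && b) inK outK)).
Qed.

Section StepLocality.

Variables (Delta : nat) (act : node_family bool) (x : arc_family nat) (s t : nat).
Hypothesis act_local : local t act.
Hypothesis x_local : arc_local t x.

Lemma arc_local_has_type u i : arc_local u (fun _ P _ v w => has_type Delta P i v w).
Proof.
apply: arc_local_map2; apply: (arc_local_map (fun p => p == _)).
  exact: arc_local_port.
exact: arc_local_rev (arc_local_port u).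
Qed.

Lemma arc_local_both_act : arc_local t (fun G P id v w => act P id v && act P id w).
Proof.
by apply: arc_local_map2; [apply: arc_local_tail | apply: arc_local_head].
Qed.

Lemma arc_local_act_arc b :
  arc_local t (fun G P id v w => act_arc id (act P id) b v w).
Proof.
apply: arc_local_map2; first exact: arc_local_adj.
apply: arc_local_map2; first exact: arc_local_both_act.
have idv := arc_local_tail (local_id t); have idw := arc_local_head (local_id t).
exact: (arc_local_map2 (fun i j => if b then j < i else i < j) idv idw).
Qed.

(** The extra round lets the tail inspect the arcs entering it. *)
Lemma arc_local_odd_class i :
  arc_local t.+1 (fun G P id v w => odd_class Delta P id (act P id) i v w).
Proof.
have typed : arc_local t (fun G P id v w =>
    act_arc id (act P id) (odd i) v w && has_type Delta P i./2 v w).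
  exact: arc_local_map2 (arc_local_act_arc _) (arc_local_has_type _ _).
apply: arc_local_map2; first exact: arc_localS.
apply/arc_local_map/arc_local_tail.
exact: (local_exists (arc_local_rev typed)).
Qed.

Lemma arc_local_odd_matching :
  arc_local (t.+1 + 2 * Delta ^ 2)
    (fun G P id v w => odd_matching Delta P id (act P id) v w).
Proof. exact: (arc_local_greedy true _ arc_local_odd_class). Qed.

Lemma local_odd_active :
  local (t + (2 * Delta ^ 2).+2) (fun G P id v => odd_active Delta P id (act P id) v).
Proof.
apply: local_map2; first by apply: local_le act_local; lia.
rewrite -addSnnS -addSnnS.
apply: (@local_map2 _ _ _ _ (fun a b => ~~ (a || b))).
  exact: local_out_arc arc_local_odd_matching.
exact: local_in_arc arc_local_odd_matching.
Qed.

Lemma arc_local_odd_weight :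
  arc_local (t + (2 * Delta ^ 2).+1)
    (fun G P id v w => odd_weight Delta P id (act P id) (x P id) s v w).
Proof.
apply: arc_local_map2; first by apply: arc_local_le x_local; lia.
rewrite -addSnnS; have K := arc_local_odd_matching.
exact: (arc_local_map2 (fun a b : bool => s * (a || b)) K (arc_local_rev K)).
Qed.

Lemma arc_local_double_matching :
  arc_local (t + Delta ^ 2) (fun G P id v w => double_matching Delta P (act P id) v w).
Proof.
apply: (@arc_local_greedy t false
  (fun i G P id v w => even_class Delta P (act P id) i v w)) => i.
apply: arc_local_map2; first exact: arc_local_adj.
apply: arc_local_map2; first exact: arc_local_both_act.
exact: arc_local_has_type.
Qed.

Lemma arc_local_single :
  arc_local (t + Delta ^ 2).+1 (fun G P id v w => single Delta P (act P id) v w).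
Proof.
have K := arc_local_double_matching.
apply: arc_local_map2; first exact: arc_localS.
apply: arc_local_map2; apply: arc_local_map.
  exact: arc_local_tail (local_in_arc K).
exact: arc_local_head (local_out_arc K).
Qed.

(** Beyond the greedy rounds, one round detects the [single] arcs and one more tells a node whether
    it is lone. *)
Lemma local_even_active :
  local (t + (Delta ^ 2).+2) (fun G P id v => even_active Delta P (act P id) v).
Proof.
rewrite !addnS; have K := arc_local_double_matching; have S1 := arc_local_single.
apply: local_map2; first by apply: local_le act_local; lia.
apply: local_map2.
  apply: localS; apply: local_map2; [exact: local_out_arc|exact: local_in_arc].
apply: (@local_map2 _ _ _ _ (fun a _ : bool => ~~ a));
  exact: (local_exists (arc_local_map2 orb S1 (arc_local_rev S1))).
Qed.

Lemma arc_local_even_weight :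
  arc_local (t + (Delta ^ 2).+2)
    (fun G P id v w => even_weight Delta P (act P id) (x P id) s v w).
Proof.
rewrite !addnS; apply: arc_localS.
have K := arc_localS arc_local_double_matching; have S1 := arc_local_single.
apply: arc_local_map2; first by apply: arc_local_le x_local; lia.
have KK := arc_local_map2 (fun a b : bool => a + b) K (arc_local_rev K).
have SS := arc_local_map2 (fun a b : bool => (a || b) : nat) S1 (arc_local_rev S1).
have [g gE] := arc_local_map2 (fun a b => s * (a + b)) KK SS.
by exists g => G P id v u vu; rewrite -gE // addnA.
Qed.

End StepLocality.

(** * The algorithm *)

Section Levels.

Variables (d Delta : nat).

Fixpoint level (i : nat) (G : sgraph) (P : port_numbering G) (id : G -> nat) :
    pred G * (G -> G -> nat) :=
  if i is j.+1 then
    let: (act, x) := level j P id in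
    let act' := odd_active Delta P id act in
    let x' := odd_weight Delta P id act x (2 ^ (d - j)) in
    (even_active Delta P act', even_weight Delta P act' x' (2 ^ (d - j.+1)))
  else (xpredT, fun _ _ => 0).

(** After [d] levels the residual capacity is one unit and the degree bound is 1; a last odd step
    brings the bound to 0. *)
Definition final_weight (G : sgraph) (P : port_numbering G) (id : G -> nat) :
    G -> G -> nat :=
  odd_weight Delta P id (level d P id).1 (level d P id).2 1.

Lemma level_local i :
  local (i * (3 * Delta ^ 2 + 4)) (fun G P id v => (level i P id).1 v) /\
  arc_local (i * (3 * Delta ^ 2 + 4)) (fun G P id v w => (level i P id).2 v w).
Proof.
elim: i => [|i [act_local x_local]] /=.
  by split; [exists (fun _ => true) | exact: arc_local_const].
have act' := local_odd_active Delta act_local.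
(* The weights are known one round before the active set; padding gives both the same time for the
   even step. *)
have x' := arc_localS (arc_local_odd_weight Delta (2 ^ (d - i)) act_local x_local).
rewrite -addnS in x'.
have act'' := local_even_active Delta act'.
have x'' := arc_local_even_weight Delta (2 ^ (d - i.+1)) act' x'.
have tE : i * (3 * Delta ^ 2 + 4) + (2 * Delta ^ 2).+2 + (Delta ^ 2).+2 =
  i.+1 * (3 * Delta ^ 2 + 4) by lia.
rewrite tE in act'' x''.
split.
  case: act'' => g gE; exists g => G P id v; rewrite -gE.
  by case: (level i P id).
case: x'' => g gE; exists g => G P id v w vw; rewrite -gE //.
by case: (level i P id).
Qed.

Hypothesis DeltaE : Delta = 2 * d + 1.

Lemma final_weight_local :
  local (5 * Delta ^ 3)
    (fun G P id v p => nth 0 [seq final_weight P id v w | w <- neighbours P v] p).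
Proof.
have [act_local x_local] := level_local d.
have /local_neighbours[g gE] := arc_local_odd_weight Delta 1 act_local x_local.
(* The [d] levels, the last odd step, and one round to bring the arc weights to the nodes. *)
apply: (@local_le (d * (3 * Delta ^ 2 + 4) + (2 * Delta ^ 2).+1).+1).
  rewrite DeltaE; nia.
by exists (fun y => nth 0 (g y)) => G P id v; rewrite -gE.
Qed.

Variables (G : sgraph) (P : port_numbering G) (id : G -> nat).
Hypothesis degG : forall v : G, deg v <= Delta.
Hypothesis id_inj : injective id.

Lemma level_partial_solution i : i <= d ->
  partial_solution (2 ^ d) (2 ^ (d - i)) (2 * (d - i)).+1
    (level i P id).1 (level i P id).2.
Proof.
elim: i => [_|i IHi ltid] /=.
  have load0 v : wload (fun _ _ : G => 0) v = 0 by rewrite /wload big1.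
  rewrite subn0; split=> //=.
  - by move=> v; rewrite load0.
  - by move=> v _; rewrite load0.
  - move=> v _; rewrite -addn1 -DeltaE; apply: leq_trans (degG v).
    by apply/subset_leq_card/subsetP=> u; rewrite !inE andbT.
move: (IHi (ltnW ltid)); case: (level i P id) => act x /= inv.
have [e def_e] : exists e, d - i = e.+1 by exists (d - i.+1); lia.
have e_def : d - i.+1 = e by lia.
rewrite def_e in inv *; rewrite e_def.
(* The degree bound goes from [2 * e + 3] to [2 * e + 2] and then to [2 * e + 1], while the capacity
   [2 ^ e.+1] is halved. *)
have := odd_stepP P degG id_inj _ inv; rewrite mul2n odd_double => /(_ isT).
rewrite expnS doubleS -mul2n; exact: even_stepP.
Qed.

Lemma final_partial_solution : exists act,
  partial_solution (2 ^ d) 1 0 act (final_weight P id).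
Proof.
have := level_partial_solution (leqnn d); rewrite subnn /= => inv.
by exists (odd_active Delta P id (level d P id).1); apply: odd_stepP inv.
Qed.

(** With degree bound 0 no two active nodes are adjacent, so every edge has an inactive end and thus
    a saturated one. *)
Lemma final_weight_saturates v u : adj v u ->
  wload (final_weight P id) v = 2 ^ d \/ wload (final_weight P id) u = 2 ^ d.
Proof.
have [act [_ _ _ x_max x_deg]] := final_partial_solution.
move=> vu; apply: (x_max v u vu); apply/negP => /andP[/x_deg + au].
by rewrite leqn0 cards_eq0 => /eqP/setP/(_ u); rewrite !inE vu au.
Qed.

End Levels.

Local Open Scope ring_scope.

(** * From symmetric integer weights on arcs to rational values on edges *)

Section EdgeWeights.

Variables (G : sgraph) (N : nat) (w : G -> G -> nat).
Hypothesis N_gt0 : (0 < N)%N.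
Hypothesis w_sym : forall v u, w v u = w u v.

(** An arbitrary ordering of the two ends is picked; symmetry of [w] makes the choice immaterial. *)
Definition edge_weight (e : {set G}) : nat :=
  if [pick vu : G * G | e == [set vu.1; vu.2]] is Some vu then w vu.1 vu.2 else 0.

Lemma set2_eq (T : finType) (a b v u : T) :
  [set a; b] = [set v; u] -> (a = v /\ b = u) \/ (a = u /\ b = v).
Proof.
move=> e.
have := set21 a b; have := set22 a b; have := set21 v u; have := set22 v u.
rewrite -{1 2}e {3 4}e !inE.
by do 4![case/orP=> /eqP ?]; subst; auto.
Qed.

Lemma edge_weightE v u : edge_weight [set v; u] = w v u.
Proof.
rewrite /edge_weight; case: pickP => [[a b] /eqP /= /set2_eq|/(_ (v, u))].
  by case=> -[-> ->].
by rewrite eqxx.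
Qed.

Definition edge_value (e : {set G}) : rat := (edge_weight e)%:R / N%:R.

(** The map from [u] to [[set v; u]] is a bijection from the neighbours of [v] to the edges at
    [v]. *)
Lemma load_edge_value v : load edge_value v = (wload w v)%:R / N%:R.
Proof.
rewrite /load -mulr_suml /wload natr_sum; congr (_ / _).
have f_inj : {in [set u | adj v u] &, injective (fun u => [set v; u])}.
  by move=> a b _ _ /set2_eq[[_ ->]|[<- ->]].
rewrite [RHS](eq_bigl (fun u => u \in [set u | adj v u])); last by move=> u; rewrite inE.
under [RHS]eq_bigr do rewrite -edge_weightE.
rewrite -(big_imset (fun e => (edge_weight e)%:R) f_inj) /=; apply: eq_bigl => e.
apply/andP/imsetP => [[/imsetP[[a b] /= ab ->]]|[u + ->]].
  rewrite inE /= in ab; rewrite !inE => /orP[] /eqP->; first by exists b; rewrite ?inE.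
  by exists a; rewrite ?inE 1?adj_sym 1?setUC.
rewrite !inE eqxx => vu; split=> //.
by apply/imsetP; exists (v, u); rewrite ?inE.
Qed.

Lemma wload_ge v u : adj v u -> (w v u <= wload w v)%N.
Proof. by move=> vu; rewrite /wload (bigD1 u) //= leq_addr. Qed.

Lemma edge_weight_le e : (forall v, wload w v <= N)%N -> e \in edges G ->
  (edge_weight e <= N)%N.
Proof.
move=> le_N /imsetP[[v u] + ->]; rewrite inE /= edge_weightE => vu.
exact: leq_trans (wload_ge vu) (le_N v).
Qed.

Lemma edge_value_maximal :
  (forall v, wload w v <= N)%N ->
  (forall v u, adj v u -> wload w v = N \/ wload w u = N) ->
  maximal_fractional_matching edge_value.
Proof.
move=> le_N sat; have Npos : (0 : rat) < N%:R by rewrite ltr0n.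
split; [split=> [e eE|v] | move=> v u /sat].
- rewrite divr_ge0 ?ler0n //= ler_pdivrMr // mul1r ler_nat.
  exact: edge_weight_le.
- by rewrite load_edge_value ler_pdivrMr // mul1r ler_nat.
- by rewrite !load_edge_value; case=> ->; [left|right]; rewrite divff ?gt_eqF.
Qed.

End EdgeWeights.

Theorem theorem1p1 (d c Delta : nat) (hc : (1 <= c)%N)
    (hDelta : Delta = (2 * d + 1)%N) :
  exists A : local_algorithm rat,
    forall (G : sgraph) (P : port_numbering G) (id : G -> nat),
      (max_degree G <= Delta)%N -> unique_identifiers c id ->
      exists x : {set G} -> rat,
        [/\ computes_within A P id (5 * Delta ^ 3)%N x,
            maximal_fractional_matching x &
            forall e, e \in edges G ->
              exists2 a : nat, (a <= 2 ^ d)%N & x e = a%:R / (2 ^ d)%:R].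
Proof.
have [g gE] := final_weight_local hDelta.
have [|A A_computes] := @local_computes rat (5 * Delta ^ 3) (fun G P id v p =>
  (nth 0%N [seq final_weight d Delta P id v w | w <- neighbours P v] p)%:R / (2 ^ d)%:R).
  by exists (fun y p => (g y p)%:R / (2 ^ d)%:R) => G P id v; rewrite -gE.
exists A => G P id degG [id_inj _].
have deg_le (v : G) : (deg v <= Delta)%N.
  by apply: leq_trans degG; apply: leq_bigmax.
have [act [w_sym w_le _ _ _]] := final_partial_solution hDelta P deg_le id_inj.
have w_sat := final_weight_saturates hDelta P deg_le id_inj.
have N_gt0 : (0 < 2 ^ d)%N by rewrite expn_gt0.
exists (edge_value (2 ^ d) (final_weight d Delta P id)); split.
- apply: A_computes => v p; rewrite /edge_value edge_weightE //.
  have vN : nbr P v p \in neighbours P v by rewrite mem_neighbours adj_nbr.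
  by rewrite (nth_map (nbr P v p)) ?index_mem // nth_index.
- exact: edge_value_maximal.
- move=> e eE; exists (edge_weight (final_weight d Delta P id) e) => //.
  exact: edge_weight_le.
Qed.
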